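(* The contravariant functors $(A,\varphi_A)\mapsto(A^0,\varphi_A^0)$, from Der pairs to Coder pairs, and $(C,\psi_C)\mapsto(C^*,\psi_C^* )$, from Coder pairs to Der pairs, are adjoint to each other; that is, for every Coder pair $(C,\psi_C)$ and every Der pair $(A,\varphi_A)$ there is a (natural) bijection $$\mathrm{Hom}_{\mathbf{Coder}}\big((C,\psi_C),(A^0,\varphi_A^0)\big)\cong\mathrm{Hom}_{\mathbf{Der}}\big((A,\varphi_A),(C^*,\psi_C^* )\big).$$
   Context: Everything is over a field $\mathbb{F}$ of characteristic $0$; $V^*=\mathrm{Hom}(V,\mathbb{F})$, and $f^*$ denotes the transpose of a linear map $f$. A coassociative coalgebra is a pair $(C,\Delta)$ with $\Delta:C\to C\otimes C$ linear and $(\mathrm{Id}_C\otimes\Delta)\circ\Delta=(\Delta\otimes\mathrm{Id}_C)\circ\Delta$. A coderivation is a linear map $\psi_C:C\to C$ with $\Delta\circ\psi_C=(\psi_C\otimes\mathrm{Id}_C)\circ\Delta+(\mathrm{Id}_C\otimes\psi_C)\circ\Delta$. A Coder pair $(C,\psi_C)$ is a coassociative coalgebra with a coderivation; a morphism $(C,\psi_C)\to(D,\psi_D)$ is a coalgebra morphism $f:C\to D$ with $\psi_D\circ f=f\circ\psi_C$. The resulting category is $\mathbf{Coder}$. A Der pair $(A,\varphi_A)$ is an associative algebra $A$ with a derivation $\varphi_A:A\to A$ (linear, $\varphi_A(ab)=\varphi_A(a)b+a\varphi_A(b)$); a morphism $(A,\varphi_A)\to(B,\varphi_B)$ is an algebra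 morphism $f:A\to B$ with $\varphi_B\circ f=f\circ\varphi_A$. The resulting category is $\mathbf{Der}$. For a coalgebra $C$, $C^*$ is the associative algebra with product $(f\cdot g)(c)=\sum f(c_{(1)})g(c_{(2)})$ where $\Delta(c)=\sum c_{(1)}\otimes c_{(2)}$; if $(C,\psi_C)$ is a Coder pair, $(C^*,\psi_C^* )$ is a Der pair. For an associative algebra $A$ with multiplication $u:A\otimes A\to A$, $A^0=\{f\in A^*\mid\ker f\text{ contains a (two-sided) ideal of finite codimension}\}$, a coalgebra with comultiplication $\Delta=\iota^{-1}\circ u^*$, where $\iota:A^*\otimes A^*\to(A\otimes A)^*$ is the canonical injection (one has $u^*(A^0)\subseteq\iota(A^0\otimes A^0)$). If $(A,\varphi_A)$ is a Der pair, then $\varphi_A^*(A^0)\subseteq A^0$, $\varphi_A^0$ denotes the restriction of $\varphi_A^*$ to $A^0$, and $(A^0,\varphi_A^0)$ is a Coder pair. On morphisms the two functors act by transposition (restricted to the finite duals in the case of $(-)^0$). *)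

(* Defs.v *)
From HB Require Import structures.
From mathcomp Require Import all_boot all_algebra.
From mathcomp Require Import boolp classical_sets.
From mathcomp Require Import freeg.

Set Implicit Arguments.
Unset Strict Implicit.
Unset Printing Implicit Defensive.

Import GRing.Theory.

Local Open Scope ring_scope.
Local Open Scope quotient_scope.

Lemma linear_ext (R : pzRingType) (U : lmodType R) (V : zmodType)
    (s : R -> V -> V) (f g : {linear U -> V | s}) : f =1 g -> f = g.
Proof.
move=> /funext; case: f g => [f [[[f1 f2]] [f3]]] [g [[[g1 g2]] [g3]]] /= fg.
case: g / fg in g1 g2 g3 *.
rewrite (Prop_irrelevance f1 g1) (Prop_irrelevance f2 g2).
by rewrite (Prop_irrelevance f3 g3).
Qed.

Definition mk_bilinear (F : fieldType) (U V W : lmodType F) (b : U -> V -> W)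
    (bl : forall v, linear (b ^~ v)) (br : forall u, linear (b u)) :
    {bilinear U -> V -> W} :=
  HB.pack b (bilinear_isBilinear.Build F U V W *:%R *:%R b (bl, br)).

Definition mk_linear (F : fieldType) (U V : lmodType F) (f : U -> V)
    (lf : linear f) : {linear U -> V} :=
  HB.pack f (GRing.isLinear.Build F U V *:%R f lf).

Section Tensor.
Variables (F : fieldType) (V W : lmodType F).

Local Notation free := {freeg (V * W)%type / F}.
Local Notation gen v w := (<< ((v, w) : (V * W)%type) >> : free).

(* The submodule of the free module on V * W spanned by the bilinearity
   relations. *)
Inductive tensor_rel : free -> Prop :=
| tensor_relL a v v' w :
    tensor_rel (gen (a *: v + v') w - (a *: gen v w + gen v' w))
| tensor_relR a v w w' :
    tensor_rel (gen v (a *: w + w') - (a *: gen v w + gen v w'))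
| tensor_rel0 : tensor_rel 0
| tensor_relP a x y : tensor_rel x -> tensor_rel y -> tensor_rel (a *: x + y).

Definition tensor_null : {pred free} := [pred x | `[<tensor_rel x>]].

Lemma tensor_nullP x : reflect (tensor_rel x) (x \in tensor_null).
Proof. exact: asboolP. Qed.

Lemma tensor_null_submod : submod_closed tensor_null.
Proof.
split=> [|a x y /tensor_nullP rx /tensor_nullP ry]; apply/tensor_nullP.
  exact: tensor_rel0.
exact: tensor_relP.
Qed.

HB.instance Definition _ :=
  GRing.isSubmodClosed.Build F free tensor_null tensor_null_submod.

Definition tensor := {ideal_quot tensor_null}.
HB.instance Definition _ := GRing.Zmodule.on tensor.

Definition tproj (x : free) : tensor := \pi x.
Definition trepr (t : tensor) : free := repr t.

Lemma treprK : cancel trepr tproj. Proof. exact: reprK. Qed.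

Lemma tproj_eq x y : (tproj x = tproj y) <-> tensor_rel (x - y).
Proof.
split=> [/eqP|/tensor_nullP rxy].
  by rewrite -Quotient.idealrBE => /tensor_nullP.
by apply/eqP; rewrite -Quotient.idealrBE.
Qed.

Lemma tprojD x y : tproj (x + y) = tproj x + tproj y.
Proof. exact: raddfD. Qed.

Definition tensor_scale (a : F) (t : tensor) : tensor := tproj (a *: trepr t).

Lemma tensor_scaleE a x : tensor_scale a (tproj x) = tproj (a *: x).
Proof.
apply/tproj_eq; rewrite -scalerBr -[_ *: _]addr0.
by apply: tensor_relP; [apply/tproj_eq; rewrite treprK | exact: tensor_rel0].
Qed.

Fact tensor_scaleA a b t :
  tensor_scale a (tensor_scale b t) = tensor_scale (a * b) t.
Proof. by rewrite -(treprK t) !tensor_scaleE scalerA. Qed.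
Fact tensor_scale1 : left_id 1 tensor_scale.
Proof. by move=> t; rewrite -(treprK t) !tensor_scaleE scale1r. Qed.
Fact tensor_scaleDr : right_distributive tensor_scale +%R.
Proof.
move=> a s t; rewrite -(treprK s) -(treprK t).
by rewrite -tprojD !tensor_scaleE -tprojD scalerDr.
Qed.
Fact tensor_scaleDl t : {morph tensor_scale^~ t : a b / a + b}.
Proof.
by move=> a b; rewrite -(treprK t) !tensor_scaleE -tprojD scalerDl.
Qed.
HB.instance Definition _ := GRing.Zmodule_isLmodule.Build F tensor
  tensor_scaleA tensor_scale1 tensor_scaleDr tensor_scaleDl.

Lemma tprojZ a x : tproj (a *: x) = a *: tproj x.
Proof. by rewrite -tensor_scaleE. Qed.

Definition tens_fun (v : V) (w : W) : tensor := tproj (gen v w).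

Fact tens_linearl w : linear (tens_fun ^~ w).
Proof.
move=> a v v'; rewrite /tens_fun -tprojZ -tprojD.
exact/tproj_eq/tensor_relL.
Qed.
Fact tens_linearr v : linear (tens_fun v).
Proof.
move=> a w w'; rewrite /tens_fun -tprojZ -tprojD.
exact/tproj_eq/tensor_relR.
Qed.
(* Locked, like tlift below, so that simplification does not expose the
   underlying quotient. *)
Definition tens : {bilinear V -> W -> tensor} :=
  locked (mk_bilinear tens_linearl tens_linearr).

Lemma tensE v w : tens v w = tproj (gen v w).
Proof. by rewrite /tens -lock. Qed.

Lemma tensorE (t : tensor) :
  exists n (v : 'I_n -> V) (w : 'I_n -> W), t = \sum_i tens (v i) (w i).
Proof.
suff [s ->] : exists s : seq (V * W), t = \sum_(p <- s) tens p.1 p.2.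
  exists (size s), (fun i => (tnth (in_tuple s) i).1).
  by exists (fun i => (tnth (in_tuple s) i).2); rewrite big_tnth.
rewrite -(treprK t) -(freeg_sumE (trepr t)).
elim: (dom _) => [|[v w] d [s IH]].
  by exists [::]; rewrite !big_nil; exact: raddf0.
exists ((coeff (v, w) (trepr t) *: v, w) :: s).
rewrite !big_cons tprojD IH; congr (_ + _).
rewrite linearZl_LR tensE -tprojZ; congr tproj.
by apply/eqP/freeg_eqP => k; rewrite coeffZ !coeffU mul1r.
Qed.

Section Lift.
Variable U : lmodType F.

Lemma fglift_linear (f : V * W -> U) : linear (fglift f).
Proof.
have fB : {morph fglift f : x y / x - y} := lift_is_additive f.
have f0 : fglift f 0 = 0 by rewrite -[0 in LHS]subr0 fB subrr.
have fN : {morph fglift f : x / - x} by move=> x; rewrite -sub0r fB f0 sub0r.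
have fD : {morph fglift f : x y / x + y}.
  by move=> x y; rewrite -[y]opprK fB -fN.
have fS := big_morph _ fD f0.
move=> a x y; rewrite fD; congr (_ + _).
rewrite -[a *: x]/(fgscale a x) fS.
rewrite -[in RHS](freeg_sumE x) fS scaler_sumr.
by apply: eq_bigr => k _; rewrite !liftU scalerA.
Qed.

Variable b : {bilinear V -> W -> U}.

(* The linear map on the tensor product induced by a bilinear map. *)
Definition tlift_fun (t : tensor) : U := fglift (fun p => b p.1 p.2) (trepr t).

Lemma tlift_tproj x : tlift_fun (tproj x) = fglift (fun p => b p.1 p.2) x.
Proof.
have : tensor_rel (trepr (tproj x) - x) by apply/tproj_eq; rewrite treprK.
rewrite /tlift_fun; set y := trepr _ => rxy.
pose g := mk_linear (fglift_linear (fun p => b p.1 p.2)).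
suff : g (y - x) = 0 by rewrite linearB => /subr0_eq.
elim: rxy => [a v v' w|a v w w'||a s t _ s0 _ t0]; last 2 first.
- exact: linear0.
- by rewrite linearP s0 t0 scaler0 addr0.
- by rewrite linearB linearP /= !liftU /= !scale1r linearPl subrr.
- by rewrite linearB linearP /= !liftU /= !scale1r linearPr subrr.
Qed.

Fact tlift_linear : linear tlift_fun.
Proof.
move=> a s t; rewrite -(treprK s) -(treprK t) -tprojZ -tprojD !tlift_tproj.
exact: fglift_linear.
Qed.
Definition tlift : {linear tensor -> U} :=
  locked (mk_linear tlift_linear).

Lemma tliftE v w : tlift (tens v w) = b v w.
Proof. by rewrite tensE /tlift -lock /= tlift_tproj liftU scale1r. Qed.

Lemma tensor_ext (f g : {linear tensor -> U}) :
  (forall v w, f (tens v w) = g (tens v w)) -> f =1 g.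
Proof.
move=> fg t; have [n [v [w ->]]] := tensorE t.
by rewrite !linear_sum; apply: eq_bigr => i _.
Qed.
End Lift.

Section Minimal.

(* A shortest expression of a tensor as a sum of pure tensors has linearly
   independent right factors. *)
Lemma tensor_min (t : tensor) : exists n (v : 'I_n -> V) (w : 'I_n -> W),
  t = \sum_i tens (v i) (w i) /\
  forall c : 'I_n -> F, \sum_i c i *: w i = 0 -> forall i, c i = 0.
Proof.
pose P n := `[< exists (v : 'I_n -> V) (w : 'I_n -> W),
                  t = \sum_i tens (v i) (w i) >].
have exP : exists n, P n.
  by have [n tE] := tensorE t; exists n; apply/asboolP.
case: (ex_minnP exP) => n /asboolP[v [w tE]] min.
exists n, v, w; split=> // c c0 i; apply/eqP/contraT => ci.
move: n v w tE min c c0 i ci => [|n] v w tE min c c0 i ci.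
  by case: (i) => m; rewrite ltn0.
suff : P n by move/min; rewrite ltnn.
apply/asboolP.
exists (fun j => v (fintype.lift i j) - (c (fintype.lift i j) / c i) *: v i).
exists (fun j => w (fintype.lift i j)).
rewrite tE (bigD1_ord i) //=.
have -> : w i = - \sum_j (c (fintype.lift i j) / c i) *: w (fintype.lift i j).
  move: c0; rewrite (bigD1_ord i) //= => /eqP; rewrite addr_eq0 => /eqP cw.
  rewrite -[w i](scalerK ci) cw scalerN scaler_sumr; congr (- _).
  by apply: eq_bigr => j _; rewrite scalerA mulrC.
have := linearNr tens (v i) => /= ->.
have := linear_sumr tens (v i) => /= ->.
rewrite -sumrN -big_split /=; apply: eq_bigr => j _.
have := linearBl tens (w (fintype.lift i j)) => /= ->.
have := linearZl_LR tens (w (fintype.lift i j)) => /= ->.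
by have := linearZr_LR tens (v i) => /= ->; rewrite addrC.
Qed.
End Minimal.

End Tensor.

Arguments tens {F V W}.

Section TensorMap.
Variables (F : fieldType) (V W V' W' : lmodType F).
Variables (f : {linear V -> V'}) (g : {linear W -> W'}).

Definition tmap_bil_fun (v : V) (w : W) : tensor V' W' := tens (f v) (g w).
Fact tmap_linearl w : linear (tmap_bil_fun ^~ w).
Proof. by move=> a v v'; rewrite /tmap_bil_fun linearP linearPl. Qed.
Fact tmap_linearr v : linear (tmap_bil_fun v).
Proof. by move=> a w w'; rewrite /tmap_bil_fun linearP linearPr. Qed.

Definition tmap : {linear tensor V W -> tensor V' W'} :=
  tlift (mk_bilinear tmap_linearl tmap_linearr).

Lemma tmapE v w : tmap (tens v w) = tens (f v) (g w).
Proof. exact: tliftE. Qed.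
End TensorMap.

Section TensorAssoc.
Variables (F : fieldType) (U V W : lmodType F).

Definition tassoc_inner_fun (w : W) (u : U) (v : V) : tensor U (tensor V W) :=
  tens u (tens v w).
Fact tassoc_innerl w v : linear ((tassoc_inner_fun w) ^~ v).
Proof. by move=> a u u'; rewrite /tassoc_inner_fun linearPl. Qed.
Fact tassoc_innerr w u : linear (tassoc_inner_fun w u).
Proof. by move=> a v v'; rewrite /tassoc_inner_fun linearPl linearPr. Qed.

Definition tassoc_bil_fun (t : tensor U V) (w : W) : tensor U (tensor V W) :=
  tlift (mk_bilinear (tassoc_innerl w) (tassoc_innerr w)) t.
Fact tassoc_linearl w : linear (tassoc_bil_fun ^~ w).
Proof. by move=> a t t'; rewrite /tassoc_bil_fun linearP. Qed.
Fact tassoc_linearr t : linear (tassoc_bil_fun t).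
Proof.
move=> a w w'; have [n [u [v ->]]] := tensorE t; rewrite /tassoc_bil_fun.
rewrite !linear_sum -big_split; apply: eq_bigr => i _.
by rewrite !tliftE /= /tassoc_inner_fun !linearPr.
Qed.

(* The canonical map (u (x) v) (x) w |-> u (x) (v (x) w). *)
Definition tassoc : {linear tensor (tensor U V) W -> tensor U (tensor V W)} :=
  tlift (mk_bilinear tassoc_linearl tassoc_linearr).

Lemma tassocE u v w :
  tassoc (tens (tens u v) w)
  = tens u (tens v w).
Proof. by rewrite tliftE /= /tassoc_bil_fun tliftE. Qed.
End TensorAssoc.

Section Dual.
Variables (F : fieldType) (V : lmodType F).

Definition dual := {linear V -> F^o}.
HB.instance Definition _ := gen_eqMixin dual.
HB.instance Definition _ := gen_choiceMixin dual.

Implicit Types f g h : dual.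

Fact dual_zero_linear : linear (fun _ : V => 0 : F^o).
Proof. by move=> a x y; rewrite scaler0 addr0. Qed.
Definition dual_zero : dual := mk_linear dual_zero_linear.
Fact dual_opp_linear f : linear (fun x => - f x).
Proof. by move=> a x y; rewrite linearP opprD scalerN. Qed.
Definition dual_opp f : dual := mk_linear (dual_opp_linear f).
Fact dual_add_linear f g : linear (fun x => f x + g x).
Proof. by move=> a x y; rewrite !linearP scalerDr addrACA. Qed.
Definition dual_add f g : dual := mk_linear (dual_add_linear f g).
Fact dual_scale_linear (c : F) f : linear (fun x => c *: f x).
Proof. by move=> a x y; rewrite linearP scalerDr !scalerA mulrC. Qed.
Definition dual_scale c f : dual := mk_linear (dual_scale_linear c f).

Fact dual_addA : associative dual_add.
Proof. by move=> f g h; apply: linear_ext => x /=; rewrite addrA. Qed.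
Fact dual_addC : commutative dual_add.
Proof. by move=> f g; apply: linear_ext => x /=; rewrite addrC. Qed.
Fact dual_add0 : left_id dual_zero dual_add.
Proof. by move=> f; apply: linear_ext => x /=; rewrite add0r. Qed.
Fact dual_addN : left_inverse dual_zero dual_opp dual_add.
Proof. by move=> f; apply: linear_ext => x /=; rewrite addNr. Qed.
HB.instance Definition _ :=
  GRing.isZmodule.Build dual dual_addA dual_addC dual_add0 dual_addN.

Fact dual_scaleA a b f : dual_scale a (dual_scale b f) = dual_scale (a * b) f.
Proof. by apply: linear_ext => x /=; rewrite scalerA. Qed.
Fact dual_scale1 : left_id 1 dual_scale.
Proof. by move=> f; apply: linear_ext => x /=; rewrite scale1r. Qed.
Fact dual_scaleDr : right_distributive dual_scale +%R.
Proof. by move=> a f g; apply: linear_ext => x /=; rewrite scalerDr. Qed.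
Fact dual_scaleDl f : {morph dual_scale^~ f : a b / a + b}.
Proof. by move=> a b; apply: linear_ext => x /=; rewrite scalerDl. Qed.
HB.instance Definition _ := GRing.Zmodule_isLmodule.Build F dual
  dual_scaleA dual_scale1 dual_scaleDr dual_scaleDl.

Lemma dualPE a f g x : (a *: f + g) x = a *: f x + g x.
Proof. by []. Qed.

End Dual.

Section Transpose.
Variables (F : fieldType) (V W : lmodType F) (f : {linear V -> W}).

Fact transpose_fun_linear (g : dual W) : linear (fun x => g (f x)).
Proof. by move=> a x y; rewrite !linearP. Qed.
Definition transpose_fun (g : dual W) : dual V :=
  mk_linear (transpose_fun_linear g).
Fact transpose_linear : linear transpose_fun.
Proof. by move=> a g h; apply: linear_ext. Qed.
Definition transpose : {linear dual W -> dual V} := mk_linear transpose_linear.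
End Transpose.

Section Iota.
Variables (F : fieldType) (V W : lmodType F).

Section Pair.
Variables (f : dual V) (g : dual W).
Definition pair_bil_fun (v : V) (w : W) : F^o := (f v : F) * (g w : F).
Fact pair_linearl w : linear (pair_bil_fun ^~ w).
Proof.
by move=> a v v'; rewrite /pair_bil_fun linearP /= mulrDl [in LHS]/GRing.scale /= -mulrA.
Qed.
Fact pair_linearr v : linear (pair_bil_fun v).
Proof.
move=> a w w'; rewrite /pair_bil_fun linearP /= mulrDr [in LHS]/GRing.scale /=.
by rewrite mulrCA.
Qed.
Definition iota_bil_fun : dual (tensor V W) :=
  tlift (mk_bilinear pair_linearl pair_linearr).

Lemma iota_bil_funE v w : iota_bil_fun (tens v w) = (f v : F) * (g w : F).
Proof. exact: tliftE. Qed.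
End Pair.

Fact iota_linearl g : linear (iota_bil_fun ^~ g).
Proof.
move=> a f f'; apply/linear_ext/tensor_ext => v w.
by rewrite dualPE !iota_bil_funE dualPE mulrDl [in LHS]/GRing.scale /= -mulrA.
Qed.
Fact iota_linearr f : linear (iota_bil_fun f).
Proof.
move=> a g g'; apply/linear_ext/tensor_ext => v w.
by rewrite dualPE !iota_bil_funE dualPE mulrDr [in LHS]/GRing.scale /= mulrCA.
Qed.

(* iota (f (x) g) maps v (x) w to f v * g w. *)
Definition iota : {linear tensor (dual V) (dual W) -> dual (tensor V W)} :=
  tlift (mk_bilinear iota_linearl iota_linearr).

Lemma iotaE f g v w : iota (tens f g) (tens v w) = (f v : F) * (g w : F).
Proof. by rewrite tliftE iota_bil_funE. Qed.

(* The functionals iota (p x (x) q y) separate the points of the tensor product when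
   the families p and q separate points. *)
Lemma iota_separates (X Y : Type) (p : X -> dual V) (q : Y -> dual W) :
    (forall v, (forall x, p x v = 0) -> v = 0) ->
    (forall w, (forall y, q y w = 0) -> w = 0) ->
  forall t, (forall x y, iota (tens (p x) (q y)) t = 0) -> t = 0.
Proof.
move=> sp sq t t0; have [n [v [w [tE wfree]]]] := tensor_min t.
suff v0 i : v i = 0.
  by rewrite tE big1 // => i _; rewrite v0 linear0l.
apply: sp => x; move: i; apply: wfree; apply: sq => y.
rewrite -[RHS](t0 x y) tE !linear_sum; apply: eq_bigr => i _.
by rewrite iotaE linearZ.
Qed.
End Iota.

Arguments tassoc {F U V W}.
Arguments iota {F V W}.

Section Pairs.
Variable F : fieldType.

Record coalgebra := Coalgebra {
  coalgebra_sort :> lmodType F;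
  comul : {linear coalgebra_sort -> tensor coalgebra_sort coalgebra_sort};
  comulA : tmap idfun comul \o comul =1 tassoc \o tmap comul idfun \o comul
}.
Arguments comul {_}.

Record coder := CoderPair {
  coder_coalgebra :> coalgebra;
  coderivation : {linear coder_coalgebra -> coder_coalgebra};
  coderivationP : comul \o coderivation =1
    (tmap coderivation idfun \o comul) \+ (tmap idfun coderivation \o comul)
}.
Arguments coderivation {_}.

Record coder_hom (C D : coder) := CoderHom {
  coder_hom_fun :> {linear C -> D};
  coder_hom_comul : comul \o coder_hom_fun =1 tmap coder_hom_fun coder_hom_fun \o comul;
  coder_hom_coderivation : coderivation \o coder_hom_fun =1 coder_hom_fun \o coderivation
}.

(* Algebras are not assumed to have a unit, nor coalgebras a counit. *)
Record algebra := Algebra {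
  algebra_sort :> lmodType F;
  amul : {bilinear algebra_sort -> algebra_sort -> algebra_sort};
  amulA : associative amul
}.
Arguments amul {_}.

Record der := DerPair {
  der_algebra :> algebra;
  derivation : {linear der_algebra -> der_algebra};
  derivationP : forall a b,
    derivation (amul a b) = amul (derivation a) b + amul a (derivation b)
}.
Arguments derivation {_}.

Record der_hom (A B : der) := DerHom {
  der_hom_fun :> {linear A -> B};
  der_hom_mul : {morph der_hom_fun : a b / amul a b};
  der_hom_derivation : derivation \o der_hom_fun =1 der_hom_fun \o derivation
}.

Lemma coder_hom_ext C D (f g : coder_hom C D) : f =1 g -> f = g.
Proof.
case: f g => [f f1 f2] [g g1 g2] /= /linear_ext fg.
case: g / fg in g1 g2 *.
by rewrite (Prop_irrelevance f1 g1) (Prop_irrelevance f2 g2).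
Qed.

Lemma der_hom_ext A B (f g : der_hom A B) : f =1 g -> f = g.
Proof.
case: f g => [f f1 f2] [g g1 g2] /= /linear_ext fg.
case: g / fg in g1 g2 *.
by rewrite (Prop_irrelevance f1 g1) (Prop_irrelevance f2 g2).
Qed.

End Pairs.

Arguments comul {F _}.
Arguments coderivation {F _}.
Arguments amul {F _}.
Arguments derivation {F _}.

Section LinearDual.
Variables (F : fieldType).

Section Coalgebra.
Variable C : coalgebra F.

Definition convolution_fun (f g : dual C) : dual C :=
  transpose (@comul _ C) (iota (tens f g)).

Lemma convolutionE f g c :
  convolution_fun f g c = iota (tens f g) (comul c).
Proof. by []. Qed.

Fact convolution_linearl g : linear (convolution_fun ^~ g).
Proof. by move=> a f f'; rewrite /convolution_fun linearPl !linearP. Qed.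
Fact convolution_linearr f : linear (convolution_fun f).
Proof. by move=> a g g'; rewrite /convolution_fun linearPr !linearP. Qed.
Definition convolution : {bilinear dual C -> dual C -> dual C} :=
  mk_bilinear convolution_linearl convolution_linearr.

Fact convolutionA : associative convolution.
Proof.
move=> f g h.
have e1 : iota (tens f (convolution_fun g h))
      =1 iota (tens f (iota (tens g h))) \o tmap idfun (@comul _ C).
  by apply: tensor_ext => x y /=; rewrite tmapE !iotaE.
have e2 : iota (tens (convolution_fun f g) h)
      =1 iota (tens (iota (tens f g)) h) \o tmap (@comul _ C) idfun.
  by apply: tensor_ext => x y /=; rewrite tmapE !iotaE.
have e3 : iota (tens f (iota (tens g h))) \o tassoc
      =1 iota (tens (iota (tens f g)) h).
  apply: tensor_ext => t z /=; rewrite iotaE.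
  have [n [x [y ->]]] := tensorE t.
  rewrite linear_sumlz !linear_sum mulr_suml; apply: eq_bigr => i _.
  by rewrite /= tassocE !iotaE mulrA.
apply: linear_ext => c.
transitivity (iota (tens f (convolution_fun g h)) (comul c)) => //.
rewrite e1; have /= -> := comulA c.
by rewrite -[RHS]/(iota (tens (convolution_fun f g) h) (comul c)) e2; exact: e3.
Qed.

Definition dual_algebra : algebra F := Algebra convolutionA.
End Coalgebra.

Section Coder.
Variable C : coder F.

Definition dual_derivation : {linear dual_algebra C -> dual_algebra C} :=
  transpose (@coderivation _ C).

Fact dual_derivationP (f g : dual_algebra C) :
  dual_derivation (amul f g)
  = amul (dual_derivation f) g + amul f (dual_derivation g).
Proof.
set psi := @coderivation _ C.
have e1 : iota (tens f g) \o tmap psi idfun =1 iota (tens (transpose psi f) g).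
  by apply: tensor_ext => x y /=; rewrite tmapE !iotaE.
have e2 : iota (tens f g) \o tmap idfun psi =1 iota (tens f (transpose psi g)).
  by apply: tensor_ext => x y /=; rewrite tmapE !iotaE.
apply: linear_ext => c; transitivity (iota (tens f g) (comul (psi c))) => //.
have /= -> := coderivationP c.
by rewrite linearD; congr (_ + _); [exact: e1 | exact: e2].
Qed.

Definition dual_der : der F := DerPair dual_derivationP.
End Coder.

Section Hom.
Variables (C D : coder F) (f : coder_hom C D).

Definition dual_hom_fun : {linear dual_der D -> dual_der C} := transpose f.

Fact dual_hom_mul : {morph dual_hom_fun : g h / amul g h}.
Proof.
move=> g h.
have e : iota (tens g h) \o tmap f f =1 iota (tens (transpose f g) (transpose f h)).
  by apply: tensor_ext => x y /=; rewrite tmapE !iotaE.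
apply: linear_ext => c; transitivity (iota (tens g h) (comul (f c))) => //.
by have /= -> := coder_hom_comul f c; exact: e.
Qed.

Fact dual_hom_derivation :
  derivation \o dual_hom_fun =1 dual_hom_fun \o derivation.
Proof.
move=> g; apply: linear_ext => c /=.
by congr (g _); have /= -> := coder_hom_coderivation f c.
Qed.

Definition dual_hom : der_hom (dual_der D) (dual_der C) :=
  DerHom dual_hom_mul dual_hom_derivation.
End Hom.
End LinearDual.

Section FiniteCodimension.
Variables (F : fieldType) (A : lmodType F).
Local Open Scope classical_set_scope.

Definition subspace (K : set A) : Prop :=
  K 0 /\ forall a x y, K x -> K y -> K (a *: x + y).

(* The quotient of A by K is spanned by finitely many classes. *)
Definition finite_codim (K : set A) : Prop :=
  exists n (e : 'I_n -> A), forall a, exists c : 'I_n -> F,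
    K (a - \sum_i c i *: e i).

Lemma subspaceZ K a x : subspace K -> K x -> K (a *: x).
Proof. by move=> [K0 KP] Kx; rewrite -[_ *: _]addr0; apply: KP. Qed.

Lemma subspaceD K x y : subspace K -> K x -> K y -> K (x + y).
Proof. by move=> [K0 KP] Kx Ky; rewrite -[x]scale1r; apply: KP. Qed.

Lemma subspaceB K x y : subspace K -> K x -> K y -> K (x - y).
Proof.
by move=> sK Kx Ky; apply: subspaceD => //; rewrite -scaleN1r; apply: subspaceZ.
Qed.

Lemma finite_codimS (K L : set A) : K `<=` L -> finite_codim K -> finite_codim L.
Proof.
move=> KL [n [e He]]; exists n, e => a.
by have [c Hc] := He a; exists c; apply: KL.
Qed.

Lemma finite_codim_ker1 (K : set A) (f : dual A) :
  subspace K -> finite_codim K -> finite_codim [set x | K x /\ f x = 0].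
Proof.
move=> sK [n [e He]].
case: (pselect (exists2 k, K k & f k <> 0)) => [[k Kk fk]|nk]; last first.
  exists n, e => a; have [c Hc] := He a; exists c; split=> //.
  by apply: contrapT => fn; apply: nk; exists (a - \sum_i c i *: e i).
exists n.+1, (fun i => if unlift ord0 i is Some j then e j else k) => a.
have [c Hc] := He a; set r := a - _ in Hc.
exists (fun i => if unlift ord0 i is Some j then c j else (f r : F) / (f k : F)).
rewrite big_ord_recl unlift_none.
under eq_bigr do rewrite liftK.
set z := _ *: k.
have -> : a - (z + \sum_i c i *: e i) = r - z.
  by rewrite /r opprD addrCA addrC.
split; first by apply: subspaceB => //; apply: subspaceZ.
rewrite linearB /z linearZ /=; apply/eqP; rewrite subr_eq0 eq_sym; apply/eqP.
by apply: divfK; apply/eqP.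
Qed.

Lemma finite_codim_kers n (f : 'I_n -> dual A) :
  finite_codim [set x | forall i, f i x = 0].
Proof.
elim: n f => [|n IH] f.
  by exists 0%N, (fun=> 0) => a; exists (fun=> 0) => -[].
have sK : subspace [set x | forall i : 'I_n, f (fintype.lift ord0 i) x = 0].
  split=> [i|a x y Kx Ky i]; first exact: linear0.
  by rewrite linearP Kx Ky scaler0 addr0.
apply: finite_codimS (finite_codim_ker1 (f ord0) sK (IH _)) => x [Kx f0] i.
by case: (unliftP ord0 i) => [j ->|->]; [exact: Kx | exact: f0].
Qed.

(* A complement of K is spanned by the e i, with coordinates f i. *)
Lemma finite_codim_coord (K : set A) : subspace K -> finite_codim K ->
  exists n (e : 'I_n -> A) (f : 'I_n -> dual A),
    (forall a, K (a - \sum_i (f i a : F) *: e i)) /\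
    (forall a, K a -> forall i, f i a = 0).
Proof.
move=> sK fK.
pose P n := `[< exists e : 'I_n -> A, forall a, exists c : 'I_n -> F,
  K (a - \sum_i c i *: e i) >].
have exP : exists n, P n by have [n He] := fK; exists n; apply/asboolP.
case: (ex_minnP exP) => n /asboolP[e He] min.
have free_e (c : 'I_n -> F) : K (\sum_i c i *: e i) -> forall i, c i = 0.
  move=> c0 i; apply/eqP/contraT => ci.
  move: n e He min c c0 i ci => [|n] e He min c c0 i ci.
    by case: (i) => m; rewrite ltn0.
  suff : P n by move/min; rewrite ltnn.
  apply/asboolP; exists (fun j => e (fintype.lift i j)) => a.
  have [d Hd] := He a.
  exists (fun j => d (fintype.lift i j) - d i / c i * c (fintype.lift i j)).
  have := subspaceD sK Hd (subspaceZ (d i / c i) sK c0).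
  rewrite !(bigD1_ord i) //= scalerDr scalerA divfK //.
  set x := (X in K X -> _); set y := a - _; suff -> : x = y by [].
  rewrite /y; under [in RHS]eq_bigr do rewrite scalerBl -scalerA.
  rewrite sumrB -scaler_sumr opprB /x opprD -addrA; congr (a + _).
  by rewrite addrACA addNr add0r addrC.
have [g Hg] := choice He.
have uniq a (c : 'I_n -> F) : K (a - \sum_i c i *: e i) -> c = g a.
  move=> Kc; apply/funext => i; apply/eqP; rewrite -subr_eq0; apply/eqP.
  apply: (free_e (fun i => c i - g a i)).
  under eq_bigr do rewrite scalerBl.
  rewrite sumrB; have := subspaceB sK (Hg a) Kc.
  by rewrite opprB addrC addrA subrK.
have lin i : linear (fun a => g a i : F^o).
  move=> a x y /=; rewrite -(uniq (a *: x + y) (fun i => a * g x i + g y i)) //.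
  have := subspaceD sK (subspaceZ a sK (Hg x)) (Hg y).
  set u := _ + _; set v := _ - _; suff -> : u = v by [].
  rewrite /v; under [in RHS]eq_bigr do rewrite scalerDl -scalerA.
  by rewrite big_split -scaler_sumr /u scalerBr opprD addrACA.
exists n, e, (fun i => mk_linear (lin i)); split=> [a|a Ka i]; first exact: Hg.
rewrite /= -(uniq a (fun=> 0)) //.
by rewrite big1 ?subr0 // => j _; rewrite scale0r.
Qed.

Lemma finite_codimI (K L : set A) : subspace K -> subspace L ->
  finite_codim K -> finite_codim L -> finite_codim (K `&` L).
Proof.
move=> sK sL fK /(finite_codim_coord sL)[n [e [f [Hf _]]]].
have [m [d [g [Hg _]]]] := finite_codim_coord sK fK.
pose h (i : 'I_(m + n)) := match fintype.split i with inl j => g j | inr j => f j end.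
apply: finite_codimS (finite_codim_kers h) => x hx; split.
  have := Hg x; rewrite big1 ?subr0 // => i _.
  have := hx (unsplit (inl i)); rewrite /h unsplitK => ->; exact: scale0r.
have := Hf x; rewrite big1 ?subr0 // => i _.
have := hx (unsplit (inr i)); rewrite /h unsplitK => ->; exact: scale0r.
Qed.

End FiniteCodimension.

Section FiniteDual.
Variables (F : fieldType) (A : algebra F).
Local Open Scope classical_set_scope.

Definition two_sided_ideal (I : set A) : Prop :=
  subspace I /\ forall a x, I x -> I (amul a x) /\ I (amul x a).

Definition in_finite_dual (f : dual A) : Prop :=
  exists I : set A,
    [/\ two_sided_ideal I, finite_codim I & I `<=` [set a | f a = 0]].

Definition finite_dual_pred : {pred dual A} := [pred f | `[<in_finite_dual f>]].

Lemma finite_dualP f : reflect (in_finite_dual f) (f \in finite_dual_pred).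
Proof. exact: asboolP. Qed.

Fact finite_dual_submod : submod_closed finite_dual_pred.
Proof.
split=> [|a f g /finite_dualP[I [[sI iI] fI If]] /finite_dualP[J [[sJ iJ] fJ Jg]]].
  apply/finite_dualP; exists setT; split=> //.
  by exists 0%N, (fun=> 0) => a; exists (fun=> 0).
apply/finite_dualP; exists (I `&` J); split.
- split=> [|b x [Ix Jx]]; last first.
    by have [? ?] := iI b x Ix; have [? ?] := iJ b x Jx.
  split=> [|b x y [Ix Jx] [Iy Jy]]; first by split; [exact: sI.1 | exact: sJ.1].
  by split; [exact: sI.2 | exact: sJ.2].
- exact: finite_codimI.
- move=> x [/If/= fx /Jg/= gx]; rewrite -[LHS]/(a *: f x + g x).
  by rewrite fx gx scaler0 addr0.
Qed.

HB.instance Definition _ :=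
  GRing.isSubmodClosed.Build F (dual A) finite_dual_pred finite_dual_submod.

Record finite_dual := FiniteDual {
  finite_dual_val : dual A;
  finite_dual_valP : finite_dual_val \in finite_dual_pred
}.
HB.instance Definition _ := [isSub for finite_dual_val].
HB.instance Definition _ := [Choice of finite_dual by <:].
HB.instance Definition _ := [SubChoice_isSubLmodule of finite_dual by <:].

Fact finite_dual_incl_linear : linear finite_dual_val.
Proof. by move=> a f g; rewrite -[LHS]/(val _) linearP. Qed.
Definition finite_dual_incl : {linear finite_dual -> dual A} :=
  mk_linear finite_dual_incl_linear.

Lemma finite_dual_ext (f g : finite_dual) :
  finite_dual_val f =1 finite_dual_val g -> f = g.
Proof. by move=> fg; apply/val_inj/linear_ext. Qed.

Fact evaluation_linear (a : A) : linear (fun f => finite_dual_val f a : F^o).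
Proof. by move=> c f g; rewrite finite_dual_incl_linear dualPE. Qed.
Definition evaluation a : dual finite_dual := mk_linear (evaluation_linear a).

Lemma evaluation_separates (f : finite_dual) :
  (forall a, evaluation a f = 0) -> f = 0.
Proof.
move=> f0; apply: finite_dual_ext => a; rewrite [LHS]f0.
by rewrite -[RHS]/(evaluation a 0) linear0.
Qed.

Definition evaluation2 a b : dual (tensor finite_dual finite_dual) :=
  iota (tens (evaluation a) (evaluation b)).

Lemma iota_inclE t a b :
  iota (tmap finite_dual_incl finite_dual_incl t) (tens a b) = evaluation2 a b t.
Proof.
pose i := finite_dual_incl.
have lin : linear (fun t => iota (tmap i i t) (tens a b) : F^o).
  by move=> c s s'; rewrite !linearP.
apply: (tensor_ext (f := mk_linear lin)) => f g /=.
by rewrite tmapE !iotaE.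
Qed.

Lemma evaluation2_separates t : (forall a b, evaluation2 a b t = 0) -> t = 0.
Proof. exact: iota_separates evaluation_separates evaluation_separates _. Qed.

Definition mul_map : {linear tensor A A -> A} := tlift amul.

(* The inclusion u^* (A^0) <= iota (A^0 (x) A^0). *)
Lemma finite_dual_comul_ex (f : finite_dual) :
  exists t : tensor finite_dual finite_dual,
    iota (tmap finite_dual_incl finite_dual_incl t)
    = transpose mul_map (finite_dual_incl f).
Proof.
have [I [[sI iI] fI If]] := finite_dualP _ (finite_dual_valP f).
have [n [e [p [pe p0]]]] := finite_codim_coord sI fI.
have pP i : p i \in finite_dual_pred.
  by apply/finite_dualP; exists I; split=> // a /p0; exact.
have lin i : linear (fun b => finite_dual_val f (amul (e i) b)).
  by move=> a x y; rewrite linearPr linearP.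
have qP i : (mk_linear (lin i) : dual A) \in finite_dual_pred.
  by apply/finite_dualP; exists I; split=> // a /(iI (e i))[/If].
exists (\sum_i tens (FiniteDual (pP i)) (FiniteDual (qP i))).
apply/linear_ext/tensor_ext => a b; rewrite iota_inclE linear_sum.
rewrite [RHS]/= tliftE.
have -> : amul a b
        = amul (a - \sum_i (p i a : F) *: e i) b + \sum_i (p i a : F) *: amul (e i) b.
  rewrite linearBl linear_sumlz.
  by under [X in _ = _ - X + _]eq_bigr do rewrite linearZl_LR; rewrite subrK.
rewrite linearD (If _ (iI b _ (pe a)).2) add0r linear_sum.
by apply: eq_bigr => i _; rewrite /evaluation2 iotaE linearZ.
Qed.

(* Delta = iota^-1 \o u^*; the tensor is unique by iota_inclE and
   evaluation2_separates. *)
Definition finite_dual_comul_fun (f : finite_dual) : tensor finite_dual finite_dual :=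
  sval (cid (finite_dual_comul_ex f)).

Lemma finite_dual_comul_funP f :
  iota (tmap finite_dual_incl finite_dual_incl (finite_dual_comul_fun f))
  = transpose mul_map (finite_dual_incl f).
Proof. exact: svalP (cid (finite_dual_comul_ex f)). Qed.

Lemma evaluation2_comul a b f :
  evaluation2 a b (finite_dual_comul_fun f) = finite_dual_val f (amul a b).
Proof. by rewrite -iota_inclE finite_dual_comul_funP /= tliftE. Qed.

Fact finite_dual_comul_linear : linear finite_dual_comul_fun.
Proof.
move=> c f g; apply/eqP; rewrite -subr_eq0; apply/eqP.
apply: evaluation2_separates => a b.
by rewrite linearB linearP !evaluation2_comul finite_dual_incl_linear subrr.
Qed.
Definition finite_dual_comul :
    {linear finite_dual -> tensor finite_dual finite_dual} :=
  locked (mk_linear finite_dual_comul_linear).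

Lemma finite_dual_comulE a b f :
  evaluation2 a b (finite_dual_comul f) = finite_dual_val f (amul a b).
Proof. by rewrite /finite_dual_comul -lock evaluation2_comul. Qed.

Fact finite_dual_comulA :
  tmap idfun finite_dual_comul \o finite_dual_comul
  =1 tassoc \o tmap finite_dual_comul idfun \o finite_dual_comul.
Proof.
move=> f /=; apply/eqP; rewrite -subr_eq0; apply/eqP.
pose q (bc : A * A) := evaluation2 bc.1 bc.2.
apply: (iota_separates (p := evaluation) (q := q)).
- exact: evaluation_separates.
- by move=> t t0; apply: evaluation2_separates => b c; exact: (t0 (b, c)).
move=> a [b c]; rewrite linearB /q /=; apply/eqP; rewrite subr_eq0; apply/eqP.
have e1 : iota (tens (evaluation a) (evaluation2 b c)) \o tmap idfun finite_dual_comul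
      =1 evaluation2 a (amul b c).
  by apply: tensor_ext => g h /=; rewrite tmapE !iotaE finite_dual_comulE.
have e2 : iota (tens (evaluation a) (evaluation2 b c)) \o tassoc
      =1 iota (tens (evaluation2 a b) (evaluation c)).
  apply: tensor_ext => t h /=; have [n [g [k ->]]] := tensorE t.
  rewrite iotaE linear_sumlz !linear_sum mulr_suml; apply: eq_bigr => i _.
  by rewrite tassocE !iotaE mulrA.
have e3 : iota (tens (evaluation2 a b) (evaluation c)) \o tmap finite_dual_comul idfun
      =1 evaluation2 (amul a b) c.
  by apply: tensor_ext => g h /=; rewrite tmapE !iotaE finite_dual_comulE.
have /= -> := e1 (finite_dual_comul f).
have /= -> := e2 (tmap finite_dual_comul idfun (finite_dual_comul f)).
have /= -> := e3 (finite_dual_comul f).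
by rewrite !finite_dual_comulE amulA.
Qed.

Definition finite_dual_coalgebra : coalgebra F := Coalgebra finite_dual_comulA.

End FiniteDual.

Arguments finite_dual_pred {F A}.

Section FiniteDualDerivation.
Variables (F : fieldType) (A : der F).
Local Open Scope classical_set_scope.

Local Notation phi := (@derivation F A).

Fact transpose_derivation_stable (f : finite_dual A) :
  transpose phi (finite_dual_val f) \in finite_dual_pred.
Proof.
have [I [[sI iI] fI If]] := finite_dualP _ (finite_dual_valP f).
have [n [e [p [pe p0]]]] := finite_codim_coord sI fI.
apply/finite_dualP; exists [set x | I x /\ I (phi x)]; split.
- split=> [|a x [Ix Ipx]].
    split=> [|c x y [Ix Ipx] [Iy Ipy]].
      by rewrite /= linear0; split; exact: sI.1.
    by rewrite /= linearP; split; exact: sI.2.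
  rewrite /= !derivationP; split; split.
  + exact: (iI a x Ix).1.
  + by apply: subspaceD => //; [exact: (iI _ x Ix).1 | exact: (iI a _ Ipx).1].
  + exact: (iI a x Ix).2.
  + by apply: subspaceD => //; [exact: (iI a _ Ipx).2 | exact: (iI _ x Ix).2].
- have kerI x : (forall i, p i x = 0) -> I x.
    by move=> px; have := pe x; rewrite big1 ?subr0 // => i _; rewrite px scale0r.
  pose h (i : 'I_(n + n)) : dual A := match fintype.split i with
    inl j => p j | inr j => transpose phi (p j) end.
  apply: finite_codimS (finite_codim_kers h) => x hx; split; apply: kerI => i.
    by have := hx (unsplit (inl i)); rewrite /h unsplitK.
  by have := hx (unsplit (inr i)); rewrite /h unsplitK.
- by move=> x [_ /If].
Qed.

Definition finite_dual_coderivation_fun (f : finite_dual A) : finite_dual A :=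
  FiniteDual (transpose_derivation_stable f).
Fact finite_dual_coderivation_linear : linear finite_dual_coderivation_fun.
Proof.
move=> c f g; apply: finite_dual_ext => a; rewrite [in RHS]finite_dual_incl_linear.
by rewrite -[LHS]/(finite_dual_val (c *: f + g) (phi a)) finite_dual_incl_linear.
Qed.
Definition finite_dual_coderivation :
    {linear finite_dual_coalgebra A -> finite_dual_coalgebra A} :=
  mk_linear finite_dual_coderivation_linear.

Fact finite_dual_coderivationP :
  comul \o finite_dual_coderivation
  =1 (tmap finite_dual_coderivation idfun \o comul)
     \+ (tmap idfun finite_dual_coderivation \o comul).
Proof.
move=> f; apply/eqP; rewrite -subr_eq0; apply/eqP.
apply: evaluation2_separates => a b; rewrite linearB; apply/eqP.
rewrite subr_eq0; apply/eqP.
have e1 : evaluation2 a b \o tmap finite_dual_coderivation idfun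
      =1 evaluation2 (phi a) b.
  by apply: tensor_ext => g h /=; rewrite tmapE /evaluation2 !iotaE.
have e2 : evaluation2 a b \o tmap idfun finite_dual_coderivation
      =1 evaluation2 a (phi b).
  by apply: tensor_ext => g h /=; rewrite tmapE /evaluation2 !iotaE.
rewrite linearD; have /= -> := e1 (comul f); have /= -> := e2 (comul f).
by rewrite !finite_dual_comulE /= derivationP linearD.
Qed.

Definition finite_dual_coder : coder F := CoderPair finite_dual_coderivationP.

End FiniteDualDerivation.

Section FiniteDualHom.
Variables (F : fieldType) (A B : der F) (g : der_hom A B).
Local Open Scope classical_set_scope.

Fact transpose_hom_stable (f : finite_dual B) :
  transpose g (finite_dual_val f) \in finite_dual_pred.
Proof.
have [I [[sI iI] fI If]] := finite_dualP _ (finite_dual_valP f).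
have [n [e [p [pe p0]]]] := finite_codim_coord sI fI.
apply/finite_dualP; exists (g @^-1` I); split.
- split=> [|a x Ix].
    split=> [|c x y Ix Iy]; first by rewrite /= /preimage /= linear0; exact: sI.1.
    by rewrite /preimage /= linearP; exact: sI.2.
  by rewrite /preimage /= !der_hom_mul; exact: iI.
- apply: finite_codimS (finite_codim_kers (fun i => transpose g (p i))) => x px.
  have := pe (g x); rewrite big1 ?subr0 // => i _.
  by have /= -> := px i; rewrite scale0r.
- by move=> x /If.
Qed.

Definition finite_dual_hom_raw (f : finite_dual B) : finite_dual A :=
  FiniteDual (transpose_hom_stable f).
Fact finite_dual_hom_linear : linear finite_dual_hom_raw.
Proof.
move=> c f h; apply: finite_dual_ext => a; rewrite [in RHS]finite_dual_incl_linear.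
by rewrite -[LHS]/(finite_dual_val (c *: f + h) (g a)) finite_dual_incl_linear.
Qed.
Definition finite_dual_hom_fun : {linear finite_dual_coder B -> finite_dual_coder A} :=
  mk_linear finite_dual_hom_linear.

Fact finite_dual_hom_comul :
  comul \o finite_dual_hom_fun =1 tmap finite_dual_hom_fun finite_dual_hom_fun \o comul.
Proof.
move=> f; apply/eqP; rewrite -subr_eq0; apply/eqP.
apply: evaluation2_separates => a b; rewrite linearB; apply/eqP.
rewrite subr_eq0; apply/eqP.
have e : evaluation2 a b \o tmap finite_dual_hom_fun finite_dual_hom_fun
      =1 evaluation2 (g a) (g b).
  by apply: tensor_ext => h k /=; rewrite tmapE /evaluation2 !iotaE.
by have /= -> := e (comul f); rewrite !finite_dual_comulE /= der_hom_mul.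
Qed.

Fact finite_dual_hom_coderivation :
  coderivation \o finite_dual_hom_fun =1 finite_dual_hom_fun \o coderivation.
Proof.
move=> f; apply: finite_dual_ext => a /=.
by have /= -> := der_hom_derivation g a.
Qed.

Definition finite_dual_hom : coder_hom (finite_dual_coder B) (finite_dual_coder A) :=
  CoderHom finite_dual_hom_comul finite_dual_hom_coderivation.
End FiniteDualHom.

Record category := Category {
  object :> Type;
  mor : object -> object -> Type;
  identity : forall X, mor X X;
  compose : forall X Y Z, mor Y Z -> mor X Y -> mor X Z;
  compose1f : forall X Y (f : mor X Y), compose (identity Y) f = f;
  composef1 : forall X Y (f : mor X Y), compose f (identity X) = f;
  composeA : forall W X Y Z (h : mor Y Z) (g : mor X Y) (f : mor W X),
    compose h (compose g f) = compose (compose h g) f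
}.
Arguments mor {_} _ _.
Arguments identity {_} _.
Arguments compose {_ _ _ _} _ _.
Notation "g ∘ f" := (compose g f) (at level 40, left associativity).

Record contravariant_functor (C D : category) := ContravariantFunctor {
  functor_object :> C -> D;
  functor_hom : forall X Y, mor X Y -> mor (functor_object Y) (functor_object X);
  functor_identity : forall X, functor_hom (identity X) = identity (functor_object X);
  functor_compose : forall X Y Z (g : mor Y Z) (f : mor X Y),
    functor_hom (g ∘ f) = functor_hom f ∘ functor_hom g
}.
Arguments functor_hom {C D} _ {X Y} _.

Section Categories.
Variable F : fieldType.

Definition coder_id (C : coder F) : coder_hom C C.
Proof.
apply: (@CoderHom _ _ _ idfun) => // x /=.
by apply: (tensor_ext (f := idfun)) => v w /=; rewrite tmapE.
Defined.

Definition coder_comp (C D E : coder F) (g : coder_hom D E) (f : coder_hom C D) :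
  coder_hom C E.
Proof.
apply: (@CoderHom _ _ _ [the {linear C -> E} of g \o f]) => x /=.
  have /= -> := coder_hom_comul g (f x); have /= -> := coder_hom_comul f x.
  apply: (tensor_ext (f := [the {linear _ -> _} of tmap g g \o tmap f f])) => v w /=.
  by rewrite !tmapE.
have /= -> := coder_hom_coderivation g (f x).
by have /= -> := coder_hom_coderivation f x.
Defined.

Definition der_id (A : der F) : der_hom A A.
Proof. by apply: (@DerHom _ _ _ idfun). Defined.

Definition der_comp (A B D : der F) (g : der_hom B D) (f : der_hom A B) :
  der_hom A D.
Proof.
apply: (@DerHom _ _ _ [the {linear A -> D} of g \o f]) => [a b|x] /=.
  by rewrite !der_hom_mul.
have /= -> := der_hom_derivation g (f x).
by have /= -> := der_hom_derivation f x.
Defined.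

Definition Coder : category.
Proof.
apply: (@Category (coder F) (@coder_hom F) coder_id coder_comp).
- by move=> X Y f; exact: coder_hom_ext.
- by move=> X Y f; exact: coder_hom_ext.
- by move=> W X Y Z h g f; exact: coder_hom_ext.
Defined.

Definition Der : category.
Proof.
apply: (@Category (der F) (@der_hom F) der_id der_comp).
- by move=> X Y f; exact: der_hom_ext.
- by move=> X Y f; exact: der_hom_ext.
- by move=> W X Y Z h g f; exact: der_hom_ext.
Defined.

Definition finite_dual_functor : contravariant_functor Der Coder.
Proof.
apply: (@ContravariantFunctor Der Coder
  (@finite_dual_coder F) (@finite_dual_hom F)).
- by move=> X; apply: coder_hom_ext => f; apply: finite_dual_ext.
- by move=> X Y Z g f; apply: coder_hom_ext => h; apply: finite_dual_ext.
Defined.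

Definition dual_functor : contravariant_functor Coder Der.
Proof.
apply: (@ContravariantFunctor Coder Der (@dual_der F) (@dual_hom F)).
- by move=> X; apply: der_hom_ext => f; apply: linear_ext.
- by move=> X Y Z g f; apply: der_hom_ext => h; apply: linear_ext.
Defined.

End Categories.

(* Main.v *)
(* Both hom-sets consist of the bilinear pairings <c, a> on C x A that turn the
   comultiplication and coderivation of C into the multiplication and derivation
   of A.  The one point to check is that, for an algebra morphism g : A -> C^*,
   every functional a |-> g a c lies in A^0: the set of all a such that g a,
   f (g a), (g a) h and f (g a) h vanish at c for all f, h in C^* is a two-sided
   ideal, and it has finite codimension because Delta c and its iterate involve
   only finitely many elements of C. *)
Require Import Defs.
From mathcomp Require Import all_boot all_algebra.
From mathcomp Require Import boolp classical_sets.

Set Implicit Arguments.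
Unset Strict Implicit.
Unset Printing Implicit Defensive.

Import GRing.Theory.

Local Open Scope ring_scope.

Section LocalFiniteness.
Variables (F : fieldType) (C : coalgebra F).
Implicit Types (u f h : dual_algebra C) (s : seq C).

(** [comul c] is a finite sum of pure tensors, and [s] collects all their factors. *)
Lemma convolution_support (c : C) : exists s, forall u, {in s, forall x, u x = 0} ->
  forall f, amul f u c = 0 /\ amul u f c = 0.
Proof.
have [n [v [w cE]]] := tensorE (comul c).
exists (codom v ++ codom w) => u u0 f; rewrite /= cE !linear_sum.
split; apply: big1 => i _; rewrite iotaE.
  by rewrite u0 ?mulr0 // mem_cat codom_f orbT.
by rewrite u0 ?mul0r // mem_cat codom_f.
Qed.

Lemma convolution_support_iter (c : C) :
  exists s, forall u, {in s, forall x, u x = 0} ->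
    [/\ u c = 0, forall f, amul f u c = 0, forall h, amul u h c = 0
      & forall f h, amul (amul f u) h c = 0].
Proof.
have [S SP] := choice convolution_support.
exists (c :: S c ++ flatten [seq S x | x <- S c]) => u u0.
have uS : {in S c, forall x, u x = 0}.
  by move=> x xS; apply: u0; rewrite inE mem_cat xS orbT.
have [ufc uhc] : (forall f, amul f u c = 0) /\ (forall h, amul u h c = 0).
  by split=> f; have [] := SP c u uS f.
split=> // [|f h]; first by apply: u0; exact: mem_head.
(* Support is used twice: [amul f u] need only vanish on [S c], which holds once [u] vanishes on
   each [S x]. *)
apply: (SP c (amul f u) _ h).2 => x xS; apply: (SP x u _ f).1 => y yS.
apply: u0; rewrite inE mem_cat orbA; apply/orP; right.
by apply/flatten_mapP; exists x.
Qed.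

End LocalFiniteness.

Section Adjunction.
Variables (F : fieldType) (C : coder F) (A : der F).
Local Open Scope classical_set_scope.

Section ToDual.
Variable f : coder_hom C (finite_dual_coder A).

Definition flip_dual_fun (a : A) : dual_der C := transpose f (evaluation a).

Fact flip_dual_linear : linear flip_dual_fun.
Proof. by move=> k a b; apply: linear_ext => c; rewrite /= linearP. Qed.

Fact flip_dual_mul : {morph mk_linear flip_dual_linear : a b / amul a b}.
Proof.
move=> a b; apply: linear_ext => c.
rewrite -[LHS]/(finite_dual_val (f c) (amul a b)) -finite_dual_comulE.
have /= -> := coder_hom_comul f c.
have e : evaluation2 a b \o tmap f f =1 Defs.iota (tens (flip_dual_fun a) (flip_dual_fun b)).
  by apply: tensor_ext => x y /=; rewrite tmapE /evaluation2 !iotaE.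
exact: e.
Qed.

Fact flip_dual_derivation :
  derivation \o mk_linear flip_dual_linear =1 mk_linear flip_dual_linear \o derivation.
Proof.
move=> a; apply: linear_ext => c.
(* The coderivation of A^0 precomposes with [derivation], so evaluating it at [a] is evaluating at
   [derivation a]. *)
exact: esym (congr1 (evaluation a) (coder_hom_coderivation f c)).
Qed.

Definition flip_dual : der_hom A (dual_der C) :=
  DerHom flip_dual_mul flip_dual_derivation.

End ToDual.

Section ToFiniteDual.
Variable g : der_hom A (dual_der C).

Fact flip_val_linear (c : C) : linear (fun a => (g a : dual C) c : F^o).
Proof. by move=> k a b; rewrite linearP. Qed.
Definition flip_val (c : C) : dual A := mk_linear (flip_val_linear c).

Lemma flip_val_finite (c : C) : flip_val c \in finite_dual_pred.
Proof.
apply/finite_dualP.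
(* Without a unit in C^*, the one-sided conditions are not instances of the two-sided one, so all
   four are imposed. *)
exists [set a | [/\ g a c = 0, forall f : dual_der C, amul f (g a) c = 0,
  forall h : dual_der C, amul (g a) h c = 0
  & forall f h : dual_der C, amul (amul f (g a)) h c = 0]]; split.
- split=> [|a x [x1 x2 x3 x4]].
    split=> [|k x y [x1 x2 x3 x4] [y1 y2 y3 y4]].
      by split=> *; rewrite linear0 ?linear0r ?linear0l.
    split=> *; rewrite linearP ?linearPr ?linearPl dualPE.
    + by rewrite x1 y1 scaler0 addr0.
    + by rewrite x2 y2 scaler0 addr0.
    + by rewrite x3 y3 scaler0 addr0.
    + by rewrite x4 y4 scaler0 addr0.
  (* By associativity the new factor [g a] is absorbed into [f] or [h], or takes its place. *)
  split; split=> *; rewrite der_hom_mul.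
  + exact: x2.
  + by rewrite amulA x2.
  + exact: x4.
  + by rewrite amulA x4.
  + exact: x3.
  + by rewrite amulA x4.
  + by rewrite -amulA x3.
  + by rewrite amulA -amulA x4.
- have [s sP] := convolution_support_iter c.
  (* The ideal contains the common kernel of the finitely many functionals [flip_val x], [x] in
     [s]. *)
  apply: finite_codimS (finite_codim_kers (fun i => flip_val (tnth (in_tuple s) i))).
  move=> a a0; apply: sP => x /(tnthP (in_tuple s))[i ->]; exact: a0.
- by move=> a [].
Qed.

Definition flip_finite_dual_fun (c : C) : finite_dual_coder A :=
  FiniteDual (flip_val_finite c).

Fact flip_finite_dual_linear : linear flip_finite_dual_fun.
Proof.
move=> k c d; apply: finite_dual_ext => a; rewrite [in RHS]finite_dual_incl_linear.
by rewrite -[LHS]/(g a (k *: c + d)) linearP.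
Qed.

Local Notation G := (mk_linear flip_finite_dual_linear).

(** Evaluations at pairs separate tensors over A^0; at (a, b) the identity becomes multiplicativity
    of [g]. *)
Fact flip_finite_dual_comul : comul \o G =1 tmap G G \o comul.
Proof.
move=> c; apply/eqP; rewrite -subr_eq0; apply/eqP.
apply: evaluation2_separates => a b; rewrite linearB; apply/eqP.
rewrite subr_eq0; apply/eqP.
have e : evaluation2 a b \o tmap G G =1 Defs.iota (tens (g a : dual C) (g b : dual C)).
  by apply: tensor_ext => x y /=; rewrite tmapE /evaluation2 !iotaE.
have /= -> := e (comul c).
by rewrite finite_dual_comulE /= der_hom_mul.
Qed.

Fact flip_finite_dual_coderivation : coderivation \o G =1 G \o coderivation.
Proof.
move=> c; apply: finite_dual_ext => a /=.
by have /= <- := der_hom_derivation g a.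
Qed.

Definition flip_finite_dual : coder_hom C (finite_dual_coder A) :=
  CoderHom flip_finite_dual_comul flip_finite_dual_coderivation.

End ToFiniteDual.

(** Both flips only swap the arguments of one pairing, so the values agree by computation. *)
Lemma flip_dualK : cancel flip_dual flip_finite_dual.
Proof. by move=> f; apply: coder_hom_ext => c; apply: finite_dual_ext. Qed.

Lemma flip_finite_dualK : cancel flip_finite_dual flip_dual.
Proof. by move=> g; apply: der_hom_ext => a; apply: linear_ext. Qed.

End Adjunction.

Theorem theorem2p1 (F : fieldType) (charF0 : [pchar F] =i pred0) :
  exists Phi : forall (C : Coder F) (A : Der F),
      mor C (finite_dual_functor F A) -> mor A (dual_functor F C),
    [/\ forall (C : Coder F) (A : Der F), bijective (Phi C A),
        forall (C C' : Coder F) (A : Der F)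
            (h : mor C' C) (f : mor C (finite_dual_functor F A)),
          Phi C' A (f ∘ h) = functor_hom (dual_functor F) h ∘ Phi C A f
      & forall (C : Coder F) (A A' : Der F)
            (g : mor A' A) (f : mor C (finite_dual_functor F A)),
          Phi C A' (functor_hom (finite_dual_functor F) g ∘ f) = Phi C A f ∘ g].
Proof.
exists (@flip_dual F); split=> [C A|C C' A h f|C A A' g f].
- exact: Bijective (@flip_dualK F C A) (@flip_finite_dualK F C A).
(* At [a] and [c] both sides compute to [f (h c)] evaluated at [a]; in the next case, to [f c]
   evaluated at [g a]. *)
- by apply: der_hom_ext => a; apply: linear_ext.
- by apply: der_hom_ext => a; apply: linear_ext.
Qed.
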